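(* Let $a,u$ be coprime positive integers with $a\neq u$. Then $P_{a,u}(t)$ has none of the following factorizations with all factors in $\mathbb{Z}[t]$: (i) $P_{a,u}=Q_1Q_2H_4$ with $\deg Q_1=\deg Q_2=2$ and $\deg H_4=4$; (ii) $P_{a,u}=Q_1Q_2Q_3Q_4$ with $\deg Q_i=2$ for $i=1,2,3,4$; (iii) $P_{a,u}=F_3G_3Q_2$ with $\deg F_3=\deg G_3=3$ and $\deg Q_2=2$.
   Context: For positive integers $a,u$, put $\Delta=u^{2}-a^{2}$ and define the even monic polynomial $$P_{a,u}(t)=t^{8}+6\Delta\,t^{6}+(\Delta^{2}-2a^{2}u^{2})\,t^{4}-6\Delta\,a^{2}u^{2}\,t^{2}+a^{4}u^{4}\in\mathbb{Z}[t].$$ *)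

(* Defs.v *)
From mathcomp Require Import all_boot all_order all_algebra.

Set Implicit Arguments.
Unset Strict Implicit.
Unset Printing Implicit Defensive.

Import GRing.Theory.
Local Open Scope ring_scope.

Definition Delta (a u : int) : int := u ^+ 2 - a ^+ 2.

Definition cuboid_poly (a u : int) : {poly int} :=
  'X^8 + (6 * Delta a u) *: 'X^6
  + (Delta a u ^+ 2 - 2 * a ^+ 2 * u ^+ 2) *: 'X^4
  - (6 * Delta a u * a ^+ 2 * u ^+ 2) *: 'X^2
  + (a ^+ 4 * u ^+ 4)%:P.

(* Exact degree: [size p] is the degree plus one for [p != 0], and [size 0] is
   0, so the zero polynomial has no degree. *)
Definition has_degree (p : {poly int}) (d : nat) : Prop := size p = d.+1.

(* Main.v *)
Require Import Defs.
From mathcomp Require Import all_boot all_order all_algebra.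
From mathcomp Require Import zify ring.

Import Order.TTheory GRing.Theory Num.Theory.
Local Open Scope ring_scope.

(** Every factorization in the list contains a factor of degree 2, so it is
    enough to show that [cuboid_poly a u] has no quadratic factor.

    Put [m = a * u] and [D = u ^+ 2 - a ^+ 2], both nonzero.  In the variable
    [s = t ^+ 2] the polynomial has degree 4, and dividing it by [s ^+ 2] gives
    [w ^+ 2 + 6 * D * w + D ^+ 2] with [w = s - m ^+ 2 / s].  The roots of this
    quadratic are irrational since its discriminant is [32 * D ^+ 2].  Suppose
    that [t ^+ 2 + b * t + c] divides the polynomial.  If [b = 0], then
    [s = - c] yields a rational [w], which is absurd.  If [b != 0], the product
    of the factor with its image under [t -> - t] is [s ^+ 2 - S * s + c ^+ 2]
    with [S = b ^+ 2 - 2 * c], and it divides the polynomial in [s].  Writing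
    that the two values of [w] at its roots have sum [- 6 * D] and product
    [D ^+ 2], and eliminating [S], one finds that
    [(c ^+ 2 - m ^+ 2) ^+ 2 + 9 * (2 * c * m) ^+ 2] is a square
    ([remainder_neq0]).  As [(c ^+ 2 - m ^+ 2) ^+ 2 + (2 * c * m) ^+ 2] is the
    square of [c ^+ 2 + m ^+ 2], the numbers [v = 2 * c * m] and
    [w = c ^+ 2 - m ^+ 2] make both [w ^+ 2 + v ^+ 2] and
    [w ^+ 2 + 9 * v ^+ 2] squares.

    This is impossible with [v * w != 0] ([not_concordant_1_9]), by infinite descent:
    the elliptic curve [y ^+ 2 = x * (x + 1) * (x + 9)] behind this system has
    rank 0.  The descent goes through the isogenous curve
    [y ^+ 2 = x * (x - 1) * (x - 4)]: [descent_isogeny] produces a solution of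
    the system that [X ^+ 2 - Y ^+ 2] and [X ^+ 2 - 4 * Y ^+ 2] are squares,
    with [Y] dividing [v * w], and [descent_isogeny_dual] writes
    [Y = +- 2 * a * b] where [(a, b)] solves the first system again.  Hence
    [`|a * b| < `|v * w|]. *)

(** * Divisibility and squares in the integers *)

Lemma prime_dvdzM (p : nat) (x y : int) : prime p ->
  (p %| x * y)%Z = (p %| x)%Z || (p %| y)%Z.
Proof. by move=> pr; rewrite !dvdzE abszM Euclid_dvdM. Qed.

Lemma prime_dvdz_sqr (p : nat) (x : int) : prime p ->
  (p %| x ^+ 2)%Z = (p %| x)%Z.
Proof. by move=> pr; rewrite expr2 prime_dvdzM // orbb. Qed.

Lemma coprimez_prime (x y : int) :
  (forall p : nat, prime p -> (p %| x)%Z -> (p %| y)%Z -> False) ->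
  coprimez x y.
Proof.
move=> noprime; rewrite coprimezE /coprime.
case: (ltngtP (gcdn `|x| `|y|)%N 1%N) => // g1.
  have g0 : gcdn `|x| `|y| = 0%N by case: gcdn g1.
  by case: (noprime 2%N); rewrite // dvdzE;
    [have := dvdn_gcdl `|x| `|y| | have := dvdn_gcdr `|x| `|y| ];
    rewrite g0 dvd0n => /eqP->; rewrite dvdn0.
case: (noprime _ (pdiv_prime g1)); rewrite dvdzE;
  apply: dvdn_trans (pdiv_dvd _) _; [exact: dvdn_gcdl|exact: dvdn_gcdr].
Qed.

Lemma prime_coprimez (p : nat) (x y : int) : prime p -> coprimez x y ->
  (p %| x)%Z -> (p %| y)%Z -> False.
Proof.
move=> pr; rewrite coprimezE /coprime => /eqP g1 px py.
have : (p %| gcdn `|x| `|y|)%N by rewrite dvdn_gcd; apply/andP.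
by rewrite g1 dvdn1 => /eqP p1; rewrite p1 in pr.
Qed.

(** A coprime factor of a square is a square; the root is the gcd with [k],
    because with [m = g * m'] coprimality makes [m'] and [g] divide each other. *)
Lemma coprime_mul_sqr (m n k : nat) : coprime m n -> (m * n = k ^ 2)%N ->
  m = (gcdn m k ^ 2)%N.
Proof.
move=> cmn mn; case: (posnP m) => [m0|m_gt0].
  by move: mn; rewrite m0 mul0n gcd0n => <-.
have g_gt0 : (0 < gcdn m k)%N by rewrite gcdn_gt0 m_gt0.
have [m' mE] := dvdnP (dvdn_gcdl m k); have [k' kE] := dvdnP (dvdn_gcdr m k).
move: g_gt0 mE kE; move eg: (gcdn m k) => g g_gt0 mE kE.
suff m'g : m' = g by rewrite mE m'g mulnn.
have cmk' : coprime m' k'.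
  by rewrite /coprime -(eqn_pmul2r g_gt0) muln_gcdl -mE -kE eg mul1n.
have eq1 : (m' * n = g * k' ^ 2)%N.
  by apply/eqP; rewrite -(eqn_pmul2r g_gt0) mulnAC -mE mn kE; apply/eqP; nia.
have cgn : coprime g n.
  by apply: coprime_dvdl cmn; rewrite mE dvdn_mull.
apply/eqP; rewrite eqn_dvd; apply/andP; split.
  rewrite -(@Gauss_dvdl m' g (k' ^ 2)%N) ?coprimeXr // -eq1 dvdn_mulr //.
by rewrite -(@Gauss_dvdl g m' n) // eq1 dvdn_mulr.
Qed.

Lemma coprimez_mul_sqr (x y k : int) : coprimez x y -> x * y = k ^+ 2 ->
  exists s, x = s ^+ 2 \/ x = - s ^+ 2.
Proof.
rewrite coprimezE => cxy xy.
have /(coprime_mul_sqr _ _ _ cxy) xE : (`|x| * `|y| = `|k| ^ 2)%N.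
  by rewrite -abszM xy abszX.
exists (gcdn `|x| `|k|)%N%:Z; lia.
Qed.

(** A square is 0 modulo 4 or 1 modulo 8.  Naming the quotients turns every
    2-adic obstruction below into a linear contradiction between squares. *)
Variant parity_spec (x : int) : Prop :=
  | EvenSqr m k of x = 2 * m & x ^+ 2 = 4 * k
  | OddSqr m k of x = 2 * m + 1 & x ^+ 2 = 8 * k + 1.

Lemma parityP (x : int) : parity_spec x.
Proof.
have [m [xE|xE]] : exists m : int, x = 2 * m \/ x = 2 * m + 1.
- by exists (x %/ 2)%Z; lia.
- by apply: (EvenSqr _ m (m ^+ 2)); rewrite // xE; ring.
have [n [mE|mE]] : exists n : int, m = 2 * n \/ m = 2 * n + 1.
- by exists (m %/ 2)%Z; lia.
- by apply: (OddSqr _ m (n * (2 * n + 1))); rewrite // xE mE; ring.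
by apply: (OddSqr _ m ((n + 1) * (2 * n + 1))); rewrite // xE mE; ring.
Qed.

Lemma coprimez_not_even (m n : int) : ~ coprimez (2 * m) (2 * n).
Proof.
by move=> c; apply: (prime_coprimez 2%N _ _ isT c); apply: dvdz_mulr.
Qed.

Lemma coprimez_mul_sqr_ge0 (x y k : int) : coprimez x y -> 0 <= x ->
  x * y = k ^+ 2 -> exists s, x = s ^+ 2.
Proof.
move=> cxy x0 /(coprimez_mul_sqr _ _ _ cxy)[s [xE|xE]]; exists s => //.
by have := sqr_ge0 s; lia.
Qed.

(** In [int] coprime factors of a square are squares only up to sign; the two
    signs agree because the product is positive. *)
Lemma coprimez_mul_sqr_both (x y k : int) : coprimez x y -> k != 0 ->
  x * y = k ^+ 2 ->
  exists a b, [/\ coprimez a b, k ^+ 2 = (a * b) ^+ 2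
    & exists s : bool, x = (-1) ^+ s * a ^+ 2 /\ y = (-1) ^+ s * b ^+ 2].
Proof.
move=> cxy k0 xy.
have cyx : coprimez y x by rewrite coprimez_sym.
have [a aE] := coprimez_mul_sqr x y k cxy xy.
have [b bE] := coprimez_mul_sqr y x k cyx (etrans (mulrC _ _) xy).
have cab : coprimez a b.
  apply: coprimez_prime => p pr pa pb; apply: (prime_coprimez p x y pr cxy).
    by case: aE => ->; rewrite ?rpredN prime_dvdz_sqr.
  by case: bE => ->; rewrite ?rpredN prime_dvdz_sqr.
have k2 : 0 < k ^+ 2 by rewrite exprn_even_gt0.
have opp_sign : k ^+ 2 = - (a * b) ^+ 2 -> False.
  by move=> kE; have := sqr_ge0 (a * b); rewrite -oppr_le0 -kE leNgt k2.
exists a, b; case: aE bE => aE [] bE; split=> //;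
  try by rewrite -xy aE bE; ring.
- by exists false; rewrite !mul1r.
- by case: opp_sign; rewrite -xy aE bE; ring.
- by case: opp_sign; rewrite -xy aE bE; ring.
- by case: opp_sign; rewrite -xy aE bE; ring.
- by case: opp_sign; rewrite -xy aE bE; ring.
- by exists true; rewrite !mulN1r.
Qed.

(** * Descent for concordant squares *)

(** The difference [e ^+ 2 - f ^+ 2 = 3 * Y ^+ 2] splits as
    [12 * g * h = 3 * Y ^+ 2] with [g] and [h] coprime, so [g] and [h] are
    squares [a ^+ 2] and [b ^+ 2] up to a common sign.  Then
    [X ^+ 2 = e ^+ 2 + Y ^+ 2] factors as the product of [a ^+ 2 + b ^+ 2] and
    [9 * a ^+ 2 + b ^+ 2], which are coprime since [X] is odd. *)
Lemma descent_isogeny_dual (X Y e f : int) : coprimez X Y -> Y != 0 ->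
  X ^+ 2 - Y ^+ 2 = e ^+ 2 -> X ^+ 2 - 4 * Y ^+ 2 = f ^+ 2 ->
  exists a b C z : int, [/\ coprimez a b, Y ^+ 2 = 4 * (a * b) ^+ 2,
    a ^+ 2 + b ^+ 2 = C ^+ 2 & 9 * a ^+ 2 + b ^+ 2 = z ^+ 2].
Proof.
move=> cXY Y0 eE fE.
have [y [YE [m XE]]] : exists y, Y = 2 * y /\ exists m, X = 2 * m + 1.
  case: (parityP X) (parityP Y) => [m k XE X2|m k XE X2] [n l YE Y2|n l YE Y2].
  - by case: (@coprimez_not_even m n); rewrite -XE -YE.
  - by case: (parityP e) => p q eE' e2; lia.
  - by exists n; split=> //; exists m.
  - by case: (parityP f) => p q fE' f2; lia.
have [n efE] : exists n, e - f = 2 * n.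
  case: (parityP X) (parityP Y) => [p k XE' X2|p k XE' X2]; first by lia.
  case=> [q l YE' Y2|q l YE' Y2]; last by lia.
  case: (parityP e) => [r v eE' e2|r v eE' e2]; first by lia.
  case: (parityP f) => [s w fE' f2|s w fE' f2]; first by lia.
  by exists (r - s); lia.
(* The prime 3 divides [e - f] or [e + f]; changing the sign of [f] decides. *)
have [f' [f'E [g eg]]] : exists f', f' ^+ 2 = f ^+ 2 /\ exists g, e - f' = 6 * g.
  have : (3%N %| (e - f) * (e + f))%Z.
    have -> : (e - f) * (e + f) = 3 * Y ^+ 2.
      have -> : (e - f) * (e + f) = e ^+ 2 - f ^+ 2 by ring.
      by rewrite -eE -fE; ring.
    exact: dvdz_mulr.
  rewrite prime_dvdzM // => /orP[] /dvdzP[k kE].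
    by exists f; split=> //; exists (n - k); lia.
  by exists (- f); split; [rewrite sqrrN | exists (f + n - k); lia].
pose h := e - 3 * g.
have ghE : g * h = y ^+ 2.
  have f'g : f' = e - 6 * g by lia.
  rewrite /h; move: eE fE; rewrite -f'E f'g YE; clear; lia.
have X2E : X ^+ 2 = (g + h) * (9 * g + h).
  have -> : (g + h) * (9 * g + h) = (h + 3 * g) ^+ 2 + 4 * (g * h) by ring.
  rewrite ghE /h; move: eE; rewrite YE; clear; lia.
have cgh : coprimez g h.
  apply: coprimez_prime => p pr pg ph; apply: (prime_coprimez p X Y pr cXY).
    by rewrite -prime_dvdz_sqr // X2E dvdz_mulr // rpredD.
  by rewrite YE dvdz_mull // -prime_dvdz_sqr // -ghE dvdz_mulr.
have y0 : y != 0 by apply: contra_neq Y0; rewrite YE => ->; rewrite mulr0.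
have [a [b [cab yE [s [gE hE]]]]] := coprimez_mul_sqr_both g h y cgh y0 ghE.
have X2E' : X ^+ 2 = (a ^+ 2 + b ^+ 2) * (9 * a ^+ 2 + b ^+ 2).
  by rewrite X2E gE hE; case: s {gE hE} => /=; ring.
have cfac : coprimez (a ^+ 2 + b ^+ 2) (9 * a ^+ 2 + b ^+ 2).
  apply: coprimez_prime => p pr p1 p9.
  have pX : (p %| X)%Z by rewrite -prime_dvdz_sqr // X2E' dvdz_mulr.
  have : (p %| 2 * (2 * (2 * a ^+ 2)))%Z.
    have -> : 2 * (2 * (2 * a ^+ 2)) =
      (9 * a ^+ 2 + b ^+ 2) - (a ^+ 2 + b ^+ 2) by ring.
    by rewrite rpredB.
  have pN2 : ~~ (p %| 2)%Z.
    apply/negP; rewrite dvdzE /= dvdn_prime2 // => /eqP p2.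
    by move: pX; rewrite p2 XE; clear; lia.
  rewrite 3?prime_dvdzM // (negPf pN2) /= prime_dvdz_sqr // => pa.
  apply: (prime_coprimez p a b pr cab) => //.
  rewrite -prime_dvdz_sqr //.
  have -> : b ^+ 2 = (a ^+ 2 + b ^+ 2) - a ^+ 2 by ring.
  by rewrite rpredB // prime_dvdz_sqr.
have a2 := sqr_ge0 a; have b2 := sqr_ge0 b.
have [C CE] : exists C, a ^+ 2 + b ^+ 2 = C ^+ 2.
  by apply: coprimez_mul_sqr_ge0 cfac _ (esym X2E'); rewrite addr_ge0.
have [z zE] : exists z, 9 * a ^+ 2 + b ^+ 2 = z ^+ 2.
  apply: (coprimez_mul_sqr_ge0 _ (a ^+ 2 + b ^+ 2) X).
  - by rewrite coprimez_sym.
  - by rewrite addr_ge0 // mulr_ge0.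
  - by rewrite mulrC.
by exists a, b, C, z; split=> //; rewrite YE exprMn yE.
Qed.

(** The two factors have no common prime but 3.  If 3 does not divide them,
    both are squares and [(s, T)] is the new solution.  Otherwise both are
    [- 3] times squares [e ^+ 2] and [f ^+ 2], and solving for [s ^+ 2] and
    [T ^+ 2] shows that [(f, e)] is a solution.  All other signs are excluded
    modulo 8. *)
Lemma descent_quartic (s T w : int) : coprimez s T -> ~~ (2 %| s)%Z ->
  T != 0 -> w != 0 -> w ^+ 2 = (s ^+ 2 - T ^+ 2) * (s ^+ 2 - 4 * T ^+ 2) ->
  exists X Y e f : int, [/\ coprimez X Y, Y != 0, (Y %| T * w)%Z,
    X ^+ 2 - Y ^+ 2 = e ^+ 2 & X ^+ 2 - 4 * Y ^+ 2 = f ^+ 2].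
Proof.
move=> csT s_odd T0 w0 wE.
have [j s2] : exists j, s ^+ 2 = 8 * j + 1.
  case: (parityP s) => [m k sE _|m k _ ->]; last by exists k.
  by rewrite sE dvdz_mulr in s_odd.
have [d3|d3] := boolP (3%N %| s ^+ 2 - T ^+ 2)%Z; last first.
  have cD : coprimez (s ^+ 2 - T ^+ 2) (s ^+ 2 - 4 * T ^+ 2).
    apply: coprimez_prime => p pr p1 p2.
    have pN3 : ~~ (p %| 3)%Z.
      apply/negP; rewrite dvdzE /= dvdn_prime2 // => /eqP pE.
      by rewrite pE in p1; rewrite p1 in d3.
    apply: (prime_coprimez p s T pr csT).
      have : (p %| 3 * s ^+ 2)%Z.
        have -> : 3 * s ^+ 2 = 4 * (s ^+ 2 - T ^+ 2) - (s ^+ 2 - 4 * T ^+ 2).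
          by ring.
        by rewrite rpredB // dvdz_mull.
      by rewrite prime_dvdzM // (negPf pN3) /= prime_dvdz_sqr.
    have : (p %| 3 * T ^+ 2)%Z.
      have -> : 3 * T ^+ 2 = (s ^+ 2 - T ^+ 2) - (s ^+ 2 - 4 * T ^+ 2) by ring.
      by rewrite rpredB.
    by rewrite prime_dvdzM // (negPf pN3) /= prime_dvdz_sqr.
  have [e [f [_ _ [[] [D1 D2]]]]] := coprimez_mul_sqr_both _ _ w cD w0 (esym wE).
    exfalso; move: D1 D2 s2; rewrite !mulN1r.
    case: (parityP T) => m k _ T2; case: (parityP e) => m' k' _ e2;
      case: (parityP f) => m'' k'' _ f2; move: T2 e2 f2; clear; lia.
  by exists s, T, e, f; split; rewrite ?dvdz_mulr // ?D1 ?D2 mul1r.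
have [d1 D1] := dvdzP d3; pose d2 := d1 - T ^+ 2.
have D2 : s ^+ 2 - 4 * T ^+ 2 = 3 * d2.
  by move: D1; rewrite /d2; clear; lia.
have /dvdzP[w' wE'] : (3%N %| w)%Z.
  by rewrite -prime_dvdz_sqr // wE dvdz_mulr.
have w'E : d1 * d2 = w' ^+ 2.
  by move: wE; rewrite D1 D2 wE'; clear; lia.
have w'0 : w' != 0 by apply: contra_neq w0; rewrite wE' => ->; rewrite mul0r.
have cd : coprimez d1 d2.
  apply: coprimez_prime => p pr p1 p2; apply: (prime_coprimez p s T pr csT).
    rewrite -prime_dvdz_sqr //.
    have -> : s ^+ 2 = 4 * d1 - d2 by rewrite /d2; move: D1; clear; lia.
    by rewrite rpredB // dvdz_mull.
  rewrite -prime_dvdz_sqr //.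
  have -> : T ^+ 2 = d1 - d2 by rewrite /d2; ring.
  by rewrite rpredB.
have [e [f [cef w'2 [[] [d1E d2E]]]]] := coprimez_mul_sqr_both _ _ w' cd w'0 w'E;
    last first.
  exfalso; move: D1 D2 s2; rewrite d1E d2E !mul1r.
  case: (parityP T) => m k _ T2; case: (parityP f) => m'' k'' _ f2;
    move: T2 f2; clear; lia.
exists f, e, T, s; split.
- by rewrite coprimez_sym.
- apply: contra_neq w'0 => e0; move/eqP: w'2.
  by rewrite e0 mul0r expr0n sqrf_eq0 => /eqP.
- rewrite dvdz_mull // wE' dvdz_mulr // -(@dvdz_pexp2r _ _ 2) // w'2.
  by rewrite exprMn dvdz_mulr.
- by move: d1E d2E; rewrite /d2 !mulN1r; clear; lia.
by move: d1E d2E D1; rewrite /d2 !mulN1r; clear; lia.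
Qed.

(** From [z ^+ 2 - C ^+ 2 = 8 * v ^+ 2], with [z] and [C] odd, the coprime
    numbers [(z - C) / 2] and [(z + C) / 2] are a square [s ^+ 2] and twice a
    square [2 * T ^+ 2] up to a common sign.  Then [v = +- s * T] and
    [C = +- (s ^+ 2 - 2 * T ^+ 2)], and [w ^+ 2 = C ^+ 2 - v ^+ 2] factors as
    in [descent_quartic]. *)
Lemma descent_isogeny (v w C z : int) : coprimez v w -> v * w != 0 ->
  v ^+ 2 + w ^+ 2 = C ^+ 2 -> 9 * v ^+ 2 + w ^+ 2 = z ^+ 2 ->
  exists X Y e f : int, [/\ coprimez X Y, Y != 0, (Y %| v * w)%Z,
    X ^+ 2 - Y ^+ 2 = e ^+ 2 & X ^+ 2 - 4 * Y ^+ 2 = f ^+ 2].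
Proof.
move=> cvw vw0 CE zE.
have [v0 w0] : v != 0 /\ w != 0 by apply/andP; rewrite -negb_or -mulf_eq0.
have [m [n [CmE zCE]]] : exists m n, C = 2 * m + 1 /\ z - C = 2 * n.
  (* Exactly one of [v] and [w] is even, so [C] is odd. *)
  have C2mod4 : exists k, C ^+ 2 = 4 * k + 1.
    case: (parityP v) => m k vE v2; case: (parityP w) => n l wE w2.
    - by case: (@coprimez_not_even m n); rewrite -vE -wE.
    - by exists (k + 2 * l); move: CE; rewrite v2 w2; clear; lia.
    - by exists (l + 2 * k); move: CE; rewrite v2 w2; clear; lia.
    by case: (parityP C) => n' l' _ C2; exfalso; move: CE v2 w2 C2; clear; lia.
  case: C2mod4 => k C2.
  case: (parityP C) => m k' mE C2'; first by exfalso; move: C2 C2'; clear; lia.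
  case: (parityP z) => n l nE z2.
    by exfalso; case: (parityP v) => ? l' _ v2; move: CE zE C2 z2 v2; clear; lia.
  by exists m, (n - m); split=> //; move: mE nE; clear; lia.
(* Exactly one of [n = (z - C) / 2] and [n + C] is even: it is [2 * h], and the
   other one is [k], whence the sign ambiguity in [C]. *)
have [h [k [hkE kodd hkC]]] : exists h k,
    [/\ h * k = v ^+ 2, ~~ (2 %| k)%Z & (k - 2 * h) ^+ 2 = C ^+ 2].
  have nE : n * (n + C) = 2 * v ^+ 2.
    have zn : z = C + 2 * n by move: zCE; clear; lia.
    have : (C + 2 * n) ^+ 2 = C ^+ 2 + 8 * v ^+ 2.
      by rewrite -zn; move: CE zE; clear; lia.
    by clear; lia.
  have [l [nl|nl]] : exists l, n = 2 * l \/ n = 2 * l + 1.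
    by exists (n %/ 2)%Z; clear; lia.
    exists l, (n + C); split.
    - by move: nE; rewrite nl; clear; lia.
    - by rewrite nl CmE; clear; lia.
    - by congr (_ ^+ 2); rewrite nl; ring.
  exists (l + m + 1), n; split.
  - by move: nE; rewrite nl CmE; clear; lia.
  - by rewrite nl; clear; lia.
  by rewrite nl CmE; ring.
have ckh : coprimez k h.
  apply: coprimez_prime => p pr pk ph; apply: (prime_coprimez p v w pr cvw).
    by rewrite -prime_dvdz_sqr // -hkE dvdz_mulr.
  rewrite -prime_dvdz_sqr //.
  have -> : w ^+ 2 = (k - 2 * h) ^+ 2 - h * k.
    by rewrite hkC hkE; move: CE; clear; lia.
  rewrite rpredB //; last by rewrite dvdz_mulr.
  by rewrite prime_dvdz_sqr // rpredB // dvdz_mull.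
have [s [T [csT v2E [sg [kE hE]]]]] :=
  coprimez_mul_sqr_both k h v ckh v0 (etrans (mulrC _ _) hkE).
have vE : v = s * T \/ v = - (s * T).
  by move/eqP: v2E; rewrite eqf_sqr => /orP[] /eqP; [left | right].
have s_odd : ~~ (2 %| s)%Z.
  by apply: contra kodd => s2; rewrite kE dvdz_mull // expr2 dvdz_mulr.
have T0 : T != 0.
  by apply: contra_neq v0 => T0; case: vE => ->; rewrite T0 mulr0 ?oppr0.
have wE : w ^+ 2 = (s ^+ 2 - T ^+ 2) * (s ^+ 2 - 4 * T ^+ 2).
  have -> : w ^+ 2 = (k - 2 * h) ^+ 2 - v ^+ 2.
    by rewrite hkC; move: CE; clear; lia.
  by rewrite v2E kE hE; case: sg {kE hE} => /=; ring.
have [X [Y [e [f [cXY Y0 dY eE fE]]]]] := descent_quartic s T w csT s_odd T0 w0 wE.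
exists X, Y, e, f; split=> //; apply: dvdz_trans dY _.
by case: vE => ->; rewrite ?mulNr ?rpredN -mulrA dvdz_mull.
Qed.

(** The numbers 1 and 9 are not concordant: the isogeny and its dual lead from
    [(v, w)] to a solution [(a, b)] with [2 * `|a * b| <= `|v * w|]. *)
Lemma not_concordant_1_9_coprime (v w C z : int) : coprimez v w ->
  v ^+ 2 + w ^+ 2 = C ^+ 2 -> 9 * v ^+ 2 + w ^+ 2 = z ^+ 2 -> v * w = 0.
Proof.
have [n] := ubnP (absz (v * w)); elim: n v w C z => // n IHn v w C z lt_n cvw CE zE.
apply/eqP; apply: contraTT isT => vw0.
have [X [Y [e [f [cXY Y0 dY eE fE]]]]] := descent_isogeny v w C z cvw vw0 CE zE.
have [a [b [C' [z' [cab YE CE' zE']]]]] := descent_isogeny_dual X Y e f cXY Y0 eE fE.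
have Yab : `|Y|%N = (2 * absz (a * b)%R)%N.
  have /eqP : Y ^+ 2 = (2 * (a * b)) ^+ 2 by rewrite YE; ring.
  by rewrite eqf_sqr => /orP[] /eqP ->; rewrite ?abszN abszM.
have leY : (absz Y <= absz (v * w)%R)%N.
  by apply: dvdn_leq; rewrite ?absz_gt0 // -dvdzE.
have Y_gt0 : (0 < `|Y|)%N by rewrite absz_gt0.
have ab0 : a * b = 0.
  apply: (IHn a b C' z') => //.
  by move: Yab leY Y_gt0 lt_n; clear; lia.
by move: Y_gt0; rewrite Yab ab0.
Qed.

Lemma not_concordant_1_9 (v w C z : int) :
  v ^+ 2 + w ^+ 2 = C ^+ 2 -> 9 * v ^+ 2 + w ^+ 2 = z ^+ 2 -> v * w = 0.
Proof.
move=> CE zE; have [->|v0] := eqVneq v 0; first by rewrite mul0r.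
have [v' vE] := dvdzP (dvdz_gcdl v w); have [w' wE] := dvdzP (dvdz_gcdr v w).
have [s [t bez]] := Bezoutz v w.
move: vE wE bez; move: (gcdz v w) => g vE wE bez.
have g0 : g != 0 by apply: contra_neq v0 => g0; rewrite vE g0 mulr0.
have c' : coprimez v' w'.
  apply/coprimezP; exists (s, t) => /=; apply: (mulIf g0).
  by rewrite mul1r -[RHS]bez [in RHS]vE [in RHS]wE; ring.
have gC : (g %| C)%Z.
  by rewrite -(@dvdz_pexp2r _ _ 2) // -CE vE wE !exprMn -mulrDl dvdz_mull.
have gz : (g %| z)%Z.
  by rewrite -(@dvdz_pexp2r _ _ 2) // -zE vE wE !exprMn mulrA -mulrDl dvdz_mull.
have [C' CE'] := dvdzP gC; have [z' zE'] := dvdzP gz.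
have g20 : g ^+ 2 != 0 by rewrite expf_neq0.
have vw' : v' * w' = 0.
  apply: (not_concordant_1_9_coprime v' w' C' z' c'); apply: (mulIf g20).
    by rewrite -exprMn -CE' -CE vE wE; ring.
  by rewrite -exprMn -zE' -zE vE wE; ring.
by rewrite vE wE mulrACA vw' mul0r.
Qed.

(** * Quadratic factors of the cuboid polynomial *)

(** Irrationality of the square root of 8. *)
Lemma sqr_neq_8sqr (x y : int) : y ^+ 2 = 8 * x ^+ 2 -> x = 0.
Proof.
move=> yE; apply/eqP; apply: contraTT isT => x0.
have /dvdzP[k kE] : (x %| y)%Z by rewrite -(@dvdz_pexp2r _ _ 2) // yE dvdz_mull.
have k8 : k ^+ 2 = 8.
  by apply: (@mulIf _ (x ^+ 2)); rewrite ?expf_neq0 // -exprMn -kE.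
case: (parityP k) => m l mE k2; last by move: k8 k2; clear; lia.
have : m ^+ 2 = 2 by move: k8; rewrite mE; clear; lia.
by case: (parityP m) => ? l' _ ->; clear; lia.
Qed.

(** Modulo [t ^+ 2 + b * t + c] one has [s ^+ 2 = S * s - c ^+ 2] for
    [s = t ^+ 2], so that the cuboid polynomial reduces to [A * s + B].  As
    [s = - b * t - c], the remainder is [- b * A * t + (B - A * c)], and the
    two hypotheses say that it vanishes. *)
Lemma remainder_neq0 (D m b c : int) : D != 0 -> m != 0 ->
  let S := b ^+ 2 - 2 * c in
  let A := S ^+ 3 - 2 * S * c ^+ 2 + 6 * D * (S ^+ 2 - c ^+ 2)
           + (D ^+ 2 - 2 * m ^+ 2) * S - 6 * D * m ^+ 2 in
  let B := m ^+ 4 - (D ^+ 2 - 2 * m ^+ 2) * c ^+ 2 - 6 * D * S * c ^+ 2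
           - c ^+ 2 * (S ^+ 2 - c ^+ 2) in
  b * A = 0 -> B = A * c -> False.
Proof.
move=> D0 m0 S A B bA BA.
have c0 : c != 0.
  apply: contra_neq m0 => c0; apply/eqP.
  suff: m ^+ 4 == 0 by rewrite expf_eq0.
  by rewrite -(mulr0 A) -[in X in A * X]c0 -BA /B c0; apply/eqP; ring.
have Dc0 : D * c != 0 by rewrite mulf_neq0.
have [b0|b0] := eqVneq b 0.
  case/negP: Dc0; apply/eqP.
  (* At the root [s = - c] one has [c * w = m ^+ 2 - c ^+ 2], and this is
     [w ^+ 2 + 6 * D * w + D ^+ 2 = 0] times [c ^+ 2], with the square
     completed. *)
  apply: (sqr_neq_8sqr _ (m ^+ 2 - c ^+ 2 + 3 * (D * c))).
  apply/eqP; rewrite -subr_eq0; apply/eqP.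
  by transitivity (B - A * c); [rewrite /B /A /S b0; ring | rewrite BA subrr].
have A0 : A = 0 by move/eqP: bA; rewrite mulf_eq0 (negPf b0) => /eqP.
have B0 : B = 0 by rewrite BA A0 mul0r.
(* The values of [w] at the two roots of [s ^+ 2 - S * s + c ^+ 2] sum up to
   [S * (1 - m ^+ 2 / c ^+ 2)], which must be [- 6 * D]. *)
have trace : S * (c ^+ 2 - m ^+ 2) = - (6 * D * c ^+ 2).
  have : (c ^+ 2 + m ^+ 2) * (S * (c ^+ 2 - m ^+ 2) + 6 * D * c ^+ 2) = 0.
    have <- : - (A * c ^+ 2 + B * S) = 0 by rewrite A0 B0; ring.
    by rewrite /A /B; ring.
  move/eqP; rewrite mulf_eq0 => /orP[|/eqP/addr0_eq <-]; last by rewrite opprK.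
  by rewrite paddr_eq0 ?sqr_ge0 // !sqrf_eq0 (negPf c0).
set N := (c ^+ 2 - m ^+ 2) ^+ 2 + 9 * (2 * c * m) ^+ 2.
(* Given [trace], the relation [B = 0] expresses the product of the two values
   of [w].  Multiplied by [(c ^+ 2 - m ^+ 2) ^+ 2], it involves [S] only through
   [S * (c ^+ 2 - m ^+ 2)], which [trace] evaluates. *)
have normE : (c ^+ 4 - m ^+ 4) ^+ 2 = N * (D * c) ^+ 2.
  have cmE : (c ^+ 2 + m ^+ 2) ^+ 2 = c ^+ 2 * (S ^+ 2 + 6 * S * D + D ^+ 2).
    apply/eqP; rewrite -subr_eq0 -[X in _ == X]B0; apply/eqP; rewrite /B; ring.
  have -> : (c ^+ 4 - m ^+ 4) ^+ 2 =
    (c ^+ 2 + m ^+ 2) ^+ 2 * (c ^+ 2 - m ^+ 2) ^+ 2 by ring.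
  rewrite cmE.
  have -> : c ^+ 2 * (S ^+ 2 + 6 * S * D + D ^+ 2) * (c ^+ 2 - m ^+ 2) ^+ 2 =
    c ^+ 2 * ((S * (c ^+ 2 - m ^+ 2)) ^+ 2
      + 6 * (S * (c ^+ 2 - m ^+ 2)) * (D * (c ^+ 2 - m ^+ 2))
      + (D * (c ^+ 2 - m ^+ 2)) ^+ 2) by ring.
  by rewrite trace /N; ring.
have /dvdzP[z zE] : (D * c %| c ^+ 4 - m ^+ 4)%Z.
  by rewrite -(@dvdz_pexp2r _ _ 2) // normE dvdz_mull.
have NE : N = z ^+ 2.
  by apply: (@mulIf _ ((D * c) ^+ 2)); rewrite ?expf_neq0 // -normE zE exprMn.
have /eqP : 2 * c * m * (c ^+ 2 - m ^+ 2) = 0.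
  apply: (not_concordant_1_9 _ _ (c ^+ 2 + m ^+ 2) z); first by ring.
  by rewrite -NE /N; ring.
rewrite !mulf_eq0 (negPf c0) (negPf m0) /= => /eqP cm.
move: trace; rewrite cm mulr0 => /esym/eqP.
by rewrite oppr_eq0 !mulf_eq0 (negPf D0) (negPf c0).
Qed.

Lemma coef_quadratic_mul (Q R : {poly int}) (n : nat) : size Q = 3%N ->
  (Q * R)`_n.+2 = Q`_2 * R`_n + Q`_1 * R`_n.+1 + Q`_0 * R`_n.+2.
Proof.
move=> sQ; have {1}-> : Q = Q`_2 *: 'X^2 + Q`_1 *: 'X + (Q`_0)%:P.
  apply/polyP => i; rewrite !coefD !coefZ coefXn coefX coefC.
  case: i => [|[|[|i]]] /=; rewrite ?mulr1 ?mulr0 ?addr0 ?add0r //.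
  by rewrite nth_default // sQ.
by rewrite !mulrDl !coefD -!scalerAl !coefZ coefXnM coefXM coefCM subn2.
Qed.

Lemma coef_cuboid_poly (a u : int) (i : nat) :
  (cuboid_poly a u)`_i = (i == 8)%:R + 6 * Delta a u * (i == 6)%:R
  + (Delta a u ^+ 2 - 2 * a ^+ 2 * u ^+ 2) * (i == 4)%:R
  - 6 * Delta a u * a ^+ 2 * u ^+ 2 * (i == 2)%:R
  + (if i == 0%N then a ^+ 4 * u ^+ 4 else 0).
Proof. by rewrite /cuboid_poly coefD coefB !coefD !coefZ !coefXn coefC. Qed.

Lemma size_quadratic_cofactor (a u : int) (Q R : {poly int}) :
  size Q = 3%N -> cuboid_poly a u = Q * R -> (size R <= 7)%N.
Proof.
move=> sQ PE; have Q0 : Q != 0 by rewrite -size_poly_eq0 sQ.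
have [->|R0] := eqVneq R 0; first by rewrite size_poly0.
have : (size (Q * R)%R <= 9)%N.
  rewrite -PE; apply/leq_sizeP => -[|[|[|[|[|[|[|[|[|j]]]]]]]]] // _.
  by rewrite coef_cuboid_poly /=; ring.
by rewrite size_mul // sQ.
Qed.

Lemma no_monic_quadratic_factor (a u : int) (Q R : {poly int}) :
  0 < a -> 0 < u -> a <> u -> size Q = 3%N -> Q`_2 = 1 ->
  cuboid_poly a u <> Q * R.
Proof.
move=> a0 u0 neq sQ lQ PE.
have D0 : Delta a u != 0.
  by rewrite /Delta subr_eq0 eqf_sqr; apply/negP => /orP[] /eqP; lia.
have m0 : a * u != 0 by rewrite mulf_neq0 // gt_eqF.
have sR := size_quadratic_cofactor a u Q R sQ PE.
have r7 : R`_7 = 0 by rewrite nth_default.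
have r8 : R`_8 = 0 by rewrite nth_default // ltnW.
have E n : (cuboid_poly a u)`_n.+2 =
    Q`_2 * R`_n + Q`_1 * R`_n.+1 + Q`_0 * R`_n.+2.
  by rewrite PE coef_quadratic_mul.
have E1 : (cuboid_poly a u)`_1 = Q`_0 * R`_1 + Q`_1 * R`_0.
  by rewrite PE coefM !big_ord_recl big_ord0 addr0.
have E0 : (cuboid_poly a u)`_0 = Q`_0 * R`_0.
  by rewrite PE coefM !big_ord_recl big_ord0 addr0.
move: (E 0%N) (E 1%N) (E 2%N) (E 3%N) (E 4%N) (E 5%N) (E 6%N) E1 E0.
rewrite !coef_cuboid_poly lQ r7 r8 /=.
rewrite !(mulr0, mulr1, mul1r, addr0, add0r, subr0, oppr0).
move: Q`_0 Q`_1 R`_0 R`_1 R`_2 R`_3 R`_4 R`_5 R`_6.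
move=> c b r0 r1 r2 r3 r4 r5 r6 e2 e3 e4 e5 e6 e7 r6E e1 e0.
(* Long division: the coefficients of the quotient, from the top down.  The two
   equations left over, [e1] and [e0], are the vanishing of the remainder. *)
have r5E : r5 = - b by move: e7; rewrite -r6E; clear; lia.
have r4E : r4 = 6 * Delta a u - b * r5 - c by move: e6; rewrite -r6E; clear; lia.
have r3E : r3 = - b * r4 - c * r5 by move: e5; clear; lia.
have r2E : r2 = Delta a u ^+ 2 - 2 * a ^+ 2 * u ^+ 2 - b * r3 - c * r4.
  by move: e4; clear; lia.
have r1E : r1 = - b * r2 - c * r3 by move: e3; clear; lia.
have r0E : r0 = - (6 * Delta a u * a ^+ 2 * u ^+ 2) - b * r1 - c * r2.
  by move: e2; clear; lia.
apply: (remainder_neq0 (Delta a u) (a * u) b c D0 m0).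
  by rewrite [RHS]e1 r0E r1E r2E r3E r4E r5E; ring.
apply/eqP; rewrite -subr_eq0; apply/eqP.
rewrite -[RHS](subrr (a ^+ 4 * u ^+ 4)) [in X in _ = _ - X]e0.
by rewrite r0E r1E r2E r3E r4E r5E; ring.
Qed.

Lemma no_quadratic_factor (a u : int) (Q R : {poly int}) :
  0 < a -> 0 < u -> a <> u -> size Q = 3%N -> cuboid_poly a u <> Q * R.
Proof.
move=> a0 u0 neq sQ PE.
have sR := size_quadratic_cofactor a u Q R sQ PE.
(* The leading coefficient of [Q] is a unit, so [Q] or [- Q] is monic. *)
have lead1 : Q`_2 * R`_6 = 1.
  transitivity ((cuboid_poly a u)`_8).
    have r7 : R`_7 = 0 by rewrite nth_default.
    have r8 : R`_8 = 0 by rewrite nth_default // ltnW.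
    by rewrite PE coef_quadratic_mul // r7 r8 !mulr0 !addr0.
  by rewrite coef_cuboid_poly /=; ring.
have : (Q`_2 %| Q`_2 * R`_6)%Z by rewrite dvdz_mulr.
rewrite lead1 dvdz1 => /eqP q2u.
have [q2E|q2E] : Q`_2 = 1 \/ Q`_2 = -1 by move: q2u; clear; lia.
  exact: (no_monic_quadratic_factor a u Q R).
apply: (no_monic_quadratic_factor a u (- Q) (- R)) => //.
- by rewrite size_polyN.
- by rewrite coefN q2E opprK.
by rewrite mulrNN.
Qed.

Theorem corollary4 (a u : int) (ha : 0 < a) (hu : 0 < u)
    (hcop : coprimez a u) (hne : a <> u) :
  [/\ ~ (exists Q1 Q2 H4 : {poly int},
          [/\ has_degree Q1 2, has_degree Q2 2, has_degree H4 4
            & cuboid_poly a u = Q1 * Q2 * H4]),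
      ~ (exists Q1 Q2 Q3 Q4 : {poly int},
          [/\ has_degree Q1 2, has_degree Q2 2, has_degree Q3 2, has_degree Q4 2
            & cuboid_poly a u = Q1 * Q2 * Q3 * Q4])
    & ~ (exists F3 G3 Q2 : {poly int},
          [/\ has_degree F3 3, has_degree G3 3, has_degree Q2 2
            & cuboid_poly a u = F3 * G3 * Q2])].
Proof.
have noQ Q R := no_quadratic_factor a u Q R ha hu hne.
split.
- by case=> Q1 [Q2 [H4 [sQ1 _ _]]]; rewrite -mulrA; exact: noQ.
- by case=> Q1 [Q2 [Q3 [Q4 [sQ1 _ _ _]]]]; rewrite -!mulrA; exact: noQ.
by case=> F3 [G3 [Q2 [_ _ sQ2]]]; rewrite mulrC; exact: noQ.
Qed.
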